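(* Let $f:[a,b]\times\mathbb{R}\to\mathbb{R}$ be of class $C^\infty$ and Lipschitz continuous in its second variable with constant $L$, and let $u\in C^\infty[a,b]$ be the solution of $u'(t)=f(t,u(t))$ on $[a,b]$, $u(a)=u_0$. Let $$c_2\neq0,\qquad a_{21}=c_2,\qquad w_1=1-\frac1{2c_2},\qquad w_2=\frac1{2c_2}.$$ Suppose that the squared shape parameters $\varepsilon_{2i}^2$, $i=0,1,\ldots,N-1$, are bounded (uniformly in $i$ and $N$). Then the MQ-RBF-based RK2 method with these parameters converges, i.e. $\mathbf{u}_N\to u(b)$ as $h=(b-a)/N\to0$.
   Context: For each positive integer $N$ put $h=(b-a)/N$ and $t_i=a+ih$, $i=0,\ldots,N$. Given real numbers $\varepsilon_{2i}^2$ ($0\le i\le N-1$, possibly depending on $N$), the MQ-RBF-based RK2 method computes approximations $\mathbf{u}_i$ to $u(t_i)$ by $\mathbf{u}_0=u_0$ and $$\mathbf{u}_{i+1}=\mathbf{u}_i+h[w_1K_1+w_2K_2],$$ $$K_1=f(t_i,\mathbf{u}_i),\qquad K_2=f\Big(t_i+c_2h,\ \Big(1+\tfrac{\varepsilon_{2i}^2(c_2h)^2}{2}\Big)\big(\mathbf{u}_i+ha_{21}K_1\big)\Big).$$ For evaluations at times outside $[a,b]$, if any, $f$ is understood to be defined there with the same smoothness and Lipschitz property. *)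

(* Defs.v *)
From Stdlib Require Import Reals.
From Coquelicot Require Import Coquelicot.

Open Scope R_scope.

Definition Icc (a b : R) (t : R) : Prop := a <= t <= b.

(* Smoothness on a set [D] of times, intended for a nondegenerate interval:
   derivatives are relative to [D], hence one-sided at the endpoints of a
   closed interval, and values outside [D] are irrelevant. *)
Fixpoint Ck (D : R -> Prop) (k : nat) (g : R -> R) : Prop :=
  continuous_on D g /\
  match k with
  | O => True
  | S k' => exists g' : R -> R, (forall t, D t -> D_in g g' D t) /\ Ck D k' g'
  end.

Definition Cinf (D : R -> Prop) (g : R -> R) : Prop := forall k, Ck D k g.

(* The two-variable analogue on [D x R]: every partial derivative of order at
   most [k], mixed ones in any order, exists and is jointly continuous. *)
Fixpoint Ck2 (D : R -> Prop) (k : nat) (g : R -> R -> R) : Prop :=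
  continuous_on (fun p : R * R => D (fst p))
                (fun p : R * R => g (fst p) (snd p)) /\
  match k with
  | O => True
  | S k' => exists gt gy : R -> R -> R,
      (forall t y, D t -> D_in (fun s => g s y) (fun s => gt s y) D t) /\
      (forall t y, D t -> is_derive (fun z => g t z) y (gy t y)) /\
      Ck2 D k' gt /\ Ck2 D k' gy
  end.

Definition Cinf2 (D : R -> Prop) (g : R -> R -> R) : Prop :=
  forall k, Ck2 D k g.

Definition step (a b : R) (N : nat) : R := (b - a) / INR N.

Definition node (a b : R) (N i : nat) : R := a + INR i * step a b N.

(* [eps2 N i] is the squared shape parameter of step [i] on the grid with [N]
   steps; being an arbitrary real, it may be negative. *)
Fixpoint mq_rk2 (f : R -> R -> R) (a b u0 c2 a21 w1 w2 : R)
    (eps2 : nat -> nat -> R) (N i : nat) : R :=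
  match i with
  | O => u0
  | S j =>
      let h := step a b N in
      let v := mq_rk2 f a b u0 c2 a21 w1 w2 eps2 N j in
      let K1 := f (node a b N j) v in
      let K2 := f (node a b N j + c2 * h)
                  ((1 + eps2 N j * (c2 * h) ^ 2 / 2) * (v + h * a21 * K1)) in
      v + h * (w1 * K1 + w2 * K2)
  end.

(* Main.v *)
Require Import Defs.
From Stdlib Require Import Reals Lra Lia.
From Coquelicot Require Import Coquelicot.
Open Scope R_scope.

(** Only consistency ([w1 + w2 = 1]) and stability are needed for convergence.
    By the mean value theorem and the uniform continuity of
    [(s, t) |-> f s (u t)] on [[A, B] x [a, b]], the increment function evaluated
    on the exact solution differs from the difference quotient of [u] by [o(1)],
    uniformly in the step, the shape-parameter factor being [1 + O(h^2)].  The
    Lipschitz condition then gives [e (i+1) <= (1 + P h) e i + h o(1)], and a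
    discrete Gronwall inequality gives [e N = o(1)]. *)

(** * Extending functions from a closed interval to the line by projection *)

Definition clamp (a b x : R) : R := Rmax a (Rmin b x).

Lemma clamp_Icc (a b x : R) : a <= b -> Icc a b (clamp a b x).
Proof.
  intros H; unfold Icc, clamp, Rmax, Rmin; repeat destruct Rle_dec; lra.
Qed.

Lemma clamp_id (a b x : R) : Icc a b x -> clamp a b x = x.
Proof.
  unfold Icc, clamp, Rmax, Rmin; intros H; repeat destruct Rle_dec; lra.
Qed.

Lemma clamp_1_Lipschitz (a b x y : R) :
  Rabs (clamp a b x - clamp a b y) <= Rabs (x - y).
Proof.
  unfold clamp, Rmax, Rmin, Rabs.
  repeat destruct Rle_dec; repeat destruct Rcase_abs; lra.
Qed.

(** All values lie in the interval and the map is 1-Lipschitz, so the limit holds in the [within]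
    filter, the one that [continuous_on] hypotheses consume. *)
Lemma filterlim_clamp (a b x : R) : a <= b ->
  filterlim (clamp a b) (locally x) (within (Icc a b) (locally (clamp a b x))).
Proof.
  intros Hab P [d Hd].
  exists d; intros y Hy.
  apply Hd; [|now apply clamp_Icc].
  exact (Rle_lt_trans _ _ _ (clamp_1_Lipschitz a b y x) Hy).
Qed.

Lemma continuous_clamp (a b x : R) : a <= b -> continuous (clamp a b) x.
Proof.
  intros Hab P HP.
  apply (filterlim_clamp a b x Hab).
  now apply filter_le_within.
Qed.

(** Turns relative continuity into two-sided continuity at every real, as required by
    [bounded_continuity], [uniform_continuity_2d] and [MVT_gen]. *)
Lemma continuous_comp_clamp (a b : R) (g : R -> R) (x : R) :
  a <= b -> continuous_on (Icc a b) g -> continuous (fun t => g (clamp a b t)) x.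
Proof.
  intros Hab Hg.
  eapply filterlim_comp; [now apply filterlim_clamp|].
  apply Hg, clamp_Icc, Hab.
Qed.

Lemma continuous_comp2_clamp (A B : R) (f : R -> R -> R) (v : R -> R) (z : R * R) :
  A <= B ->
  continuous_on (fun p : R * R => Icc A B (fst p)) (fun p => f (fst p) (snd p)) ->
  continuous v (snd z) ->
  continuous (fun p : R * R => f (clamp A B (fst p)) (v (snd p))) z.
Proof.
  intros HAB Hf Hv.
  unfold continuous.
  apply (filterlim_comp _ _ _ (fun p : R * R => (clamp A B (fst p), v (snd p)))
    (fun p => f (fst p) (snd p)) (locally z)
    (within (fun p : R * R => Icc A B (fst p))
      (locally (clamp A B (fst z), v (snd z))))).
  - assert (Hc : continuous (fun p : R * R => (clamp A B (fst p), v (snd p))) z).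
    { apply (continuous_comp_2 (fun p : R * R => clamp A B (fst p))
        (fun p => v (snd p)) pair).
      - apply (continuous_comp fst (clamp A B));
          [apply continuous_fst | now apply continuous_clamp].
      - now apply (continuous_comp snd v); [apply continuous_snd|].
      (* Uncurried, [pair] is the identity of the product. *)
      - apply (continuous_ext (fun p : R * R => p)); [now intros []|].
        apply continuous_id. }
    intros P HP; unfold filtermap.
    apply (filter_imp (fun p : R * R =>
      Icc A B (clamp A B (fst p)) -> P (clamp A B (fst p), v (snd p)))).
    + intros p Hp; apply Hp, clamp_Icc, HAB.
    + exact (Hc _ HP).
  - apply (Hf (clamp A B (fst z), v (snd z))), clamp_Icc, HAB.
Qed.

(** Increments smaller than the distance to both endpoints stay in the interval, so the relative
    derivative is two-sided there. The function [v] is meant to be the extension of [u]. *)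
Lemma D_in_interior_is_derive (a b : R) (u g v : R -> R) (t : R) :
  a < t < b -> D_in u g (Icc a b) t ->
  (forall s, Icc a b s -> v s = u s) -> is_derive v t (g t).
Proof.
  intros Ht Hd Hv.
  apply is_derive_Reals.
  intros eps Heps.
  destruct (Hd eps Heps) as (al & Hal & H).
  assert (Hm : 0 < Rmin al (Rmin (t - a) (b - t)))
    by (repeat apply Rmin_pos; lra).
  exists (mkposreal _ Hm); simpl; intros k Hk Hkm.
  pose proof (Rmin_l al (Rmin (t - a) (b - t))).
  pose proof (Rmin_r al (Rmin (t - a) (b - t))).
  pose proof (Rmin_l (t - a) (b - t)).
  pose proof (Rmin_r (t - a) (b - t)).
  assert (Hkb : - (t - a) <= k <= b - t).
  { assert (Hk' : Rabs k <= Rmin (t - a) (b - t)) by lra.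
    apply Rabs_le_between in Hk'; lra. }
  assert (Htk : Icc a b (t + k)) by (unfold Icc; lra).
  rewrite !Hv by (unfold Icc in *; lra).
  assert (E : t + k - t = k) by ring.
  specialize (H (t + k)); simpl in H; unfold Rdist in H; rewrite E in H.
  apply H; split; [split|]; [exact Htk | lra | lra].
Qed.

(** By induction [e i <= i q (1+p)^i], the new [q] being absorbed because [(1+p)^(i+1) >= 1]; then
    [1 + p <= exp p]. No division by [p] occurs, so [p = 0] is allowed. *)
Lemma discrete_gronwall (e : nat -> R) (p q : R) (N : nat) :
  0 <= p -> 0 <= q -> e O = 0 ->
  (forall i, (i < N)%nat -> e (S i) <= (1 + p) * e i + q) ->
  e N <= INR N * q * exp (INR N * p).
Proof.
  intros Hp Hq H0 Hs.
  assert (Hpow : forall i, (i <= N)%nat -> e i <= INR i * q * (1 + p) ^ i).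
  { induction i as [|i IH]; intros Hi.
    - rewrite H0; simpl; lra.
    - rewrite S_INR; simpl.
      specialize (Hs i Hi).
      assert (HI := IH ltac:(lia)).
      assert (H1 : (1 + p) * e i <= (1 + p) * (INR i * q * (1 + p) ^ i))
        by (apply Rmult_le_compat_l; lra).
      assert (H2 : 1 <= (1 + p) ^ S i) by (apply pow_R1_Rle; lra).
      assert (H3 : q * 1 <= q * (1 + p) ^ S i) by now apply Rmult_le_compat_l.
      simpl in H3; lra. }
  eapply Rle_trans; [now apply Hpow|].
  apply Rmult_le_compat_l; [apply Rmult_le_pos; [apply pos_INR|exact Hq]|].
  replace (exp (INR N * p)) with (exp p ^ N)
    by (rewrite <- Rpower_pow by apply exp_pos; unfold Rpower; now rewrite ln_exp).
  apply pow_incr; split; [lra|]; apply exp_ineq1_le.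
Qed.

(** * Error propagation over one step *)

Lemma Rabs_plus_le (x y c d : R) :
  Rabs x <= c -> Rabs y <= d -> Rabs (x + y) <= c + d.
Proof.
  intros; eapply Rle_trans; [apply Rabs_triang|lra].
Qed.

Lemma Rabs_mult_le (x y c d : R) :
  Rabs x <= c -> Rabs y <= d -> Rabs (x * y) <= c * d.
Proof.
  intros; rewrite Rabs_mult.
  apply Rmult_le_compat; trivial; apply Rabs_pos.
Qed.

(** A Lipschitz constant of the increment [w1 K1 + w2 K2] in the starting value, uniform over
    [h <= H] and shape perturbations of size at most [T]. *)
Definition rate (L w1 w2 c H T : R) : R :=
  Rabs w1 * L + Rabs w2 * (L * ((1 + T) * (1 + H * (Rabs c * L)))).

(** Started from the exact value, the second stage is displaced by at most [h] times the inner sum: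
    [C X] comes from the shape factor, the rest from the Euler predictor. *)
Definition residual (L w2 c T C X G : R) : R :=
  Rabs w2 * (L * (C * X + (1 + T) * (Rabs c * G))).

(* [x], [x'] are the exact values at both ends of the step, [g] the exact slope
   at its left end, [s] a mean slope, [th] the relative perturbation due to the
   shape parameter. *)
Lemma one_step_error (L w1 w2 c H T C X G eta h th x x' g s v K1 K2 : R) :
  0 <= L -> 0 <= h <= H -> w1 + w2 = 1 ->
  Rabs th <= T -> Rabs th <= C * h -> Rabs x <= X -> Rabs g <= G ->
  x' - x = s * h -> Rabs (s - g) <= eta ->
  Rabs (K1 - g) <= L * Rabs (v - x) ->
  Rabs (K2 - g) <= L * Rabs ((1 + th) * (v + h * c * K1) - x) + eta ->
  Rabs (v + h * (w1 * K1 + w2 * K2) - x')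
  <= (1 + h * rate L w1 w2 c H T) * Rabs (v - x)
     + h * (h * residual L w2 c T C X G + (1 + Rabs w2) * eta).
Proof.
  intros HL Hh Hw HT HC HX HG Hx' Hs HK1 HK2.
  set (E := Rabs (v - x)) in *.
  assert (HE : 0 <= E) by apply Rabs_pos.
  assert (Hc : 0 <= Rabs c) by apply Rabs_pos.
  assert (Hah : Rabs h <= h) by (rewrite Rabs_pos_eq; lra).
  assert (H1 : Rabs (1 + th) <= 1 + T)
    by (apply Rabs_plus_le; [rewrite Rabs_R1; lra|exact HT]).
  assert (HT0 : 0 <= 1 + T) by (pose proof (Rabs_pos (1 + th)); lra).
  assert (HK1' : Rabs K1 <= L * E + G).
  { replace K1 with ((K1 - g) + g) by ring; now apply Rabs_plus_le. }
  assert (Hstage : Rabs ((1 + th) * (v + h * c * K1) - x)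
      <= (1 + T) * (E + H * (Rabs c * L) * E)
         + h * (C * X + (1 + T) * (Rabs c * G))).
  { replace ((1 + th) * (v + h * c * K1) - x)
      with ((1 + th) * ((v - x) + h * (c * K1)) + th * x) by ring.
    apply Rle_trans with ((1 + T) * (E + h * (Rabs c * (L * E + G))) + C * h * X).
    - apply Rabs_plus_le; apply Rabs_mult_le; trivial.
      apply Rabs_plus_le; [apply Rle_refl|].
      apply Rabs_mult_le; trivial.
      apply Rabs_mult_le; [apply Rle_refl|trivial].
    (* This is exactly the slack gained by replacing [h] with [H] in the coefficient of [E]. *)
    - assert (HP : 0 <= (1 + T) * (Rabs c * L * E) * (H - h)).
      { repeat apply Rmult_le_pos; lra. }
      lra. }
  assert (HK2' := Rmult_le_compat_l L _ _ HL Hstage).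
  (* Since [w1 + w2 = 1], the slope [g] can be subtracted from [K1], [K2] and [s] alike. *)
  replace (v + h * (w1 * K1 + w2 * K2) - x')
    with ((v - x) + h * (w1 * (K1 - g) + w2 * (K2 - g) + - (s - g)))
    by (replace x' with (x + s * h) by lra;
        replace w1 with (1 - w2) by lra; ring).
  eapply Rle_trans.
  { apply Rabs_plus_le; [apply Rle_refl|].
    apply Rabs_mult_le; [exact Hah|].
    apply Rabs_plus_le; [apply Rabs_plus_le; apply Rabs_mult_le|].
    - apply Rle_refl.
    - exact HK1.
    - apply Rle_refl.
    - eapply Rle_trans; [exact HK2|].
      apply Rplus_le_compat_r, HK2'.
    - rewrite Rabs_Ropp; exact Hs. }
  unfold rate, residual; fold E.
  apply Req_le; ring.
Qed.

(** * The grid *)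

Lemma is_lim_seq_step (a b : R) : is_lim_seq (step a b) 0.
Proof.
  unfold step, Rdiv.
  replace (Finite 0) with (Rbar_mult (b - a) 0) by (simpl; f_equal; ring).
  apply is_lim_seq_scal_l.
  replace (Finite 0) with (Rbar_inv p_infty) by reflexivity.
  apply is_lim_seq_inv; [apply is_lim_seq_INR|discriminate].
Qed.

Lemma step_mult (a b : R) (N : nat) : (0 < N)%nat -> INR N * step a b N = b - a.
Proof.
  intros HN; unfold step; field.
  now apply not_0_INR; lia.
Qed.

Lemma node_Icc (a b : R) (N i : nat) :
  a <= b -> (0 < N)%nat -> (i <= N)%nat -> Icc a b (node a b N i).
Proof.
  intros Hab HN Hi.
  pose proof (step_mult a b N HN) as Hs.
  assert (Hp : 0 < INR N) by now apply lt_0_INR.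
  assert (Hh : 0 <= step a b N)
    by (unfold step, Rdiv; apply Rmult_le_pos;
        [lra | now apply Rlt_le, Rinv_0_lt_compat]).
  assert (H0 : 0 <= INR i * step a b N)
    by (apply Rmult_le_pos; [apply pos_INR|exact Hh]).
  assert (H1 : INR i * step a b N <= INR N * step a b N)
    by (apply Rmult_le_compat_r; [exact Hh|now apply le_INR]).
  unfold Icc, node; lra.
Qed.

Lemma lipschitz_const_nonneg (F : R -> R) (L : R) :
  (forall y z, Rabs (F y - F z) <= L * Rabs (y - z)) -> 0 <= L.
Proof.
  intros H; specialize (H 1 0).
  replace (1 - 0) with 1 in H by ring.
  rewrite Rabs_R1 in H.
  pose proof (Rabs_pos (F 1 - F 0)); lra.
Qed.

(** * Convergence at the final time [b] *)

Theorem theorem1 (a b A B L u0 c2 a21 w1 w2 : R)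
    (f : R -> R -> R) (u : R -> R) (eps2 : nat -> nat -> R)
    (hab : a < b)
    (* [A, B] contains [a, b] and every time at which f is evaluated;
       A = a and B = b is allowed when 0 < c2 <= 1 *)
    (hA : A <= a) (hB : b <= B)
    (heval : forall N i : nat, (i < N)%nat ->
       Icc A B (node a b N i + c2 * step a b N))
    (hf : Cinf2 (Icc A B) f)
    (hL : forall t y z, Icc A B t -> Rabs (f t y - f t z) <= L * Rabs (y - z))
    (hu : Cinf (Icc a b) u)
    (hode : forall t, Icc a b t -> D_in u (fun s => f s (u s)) (Icc a b) t)
    (hu0 : u a = u0)
    (hc2 : c2 <> 0)
    (ha21 : a21 = c2)
    (hw1 : w1 = 1 - 1 / (2 * c2))
    (hw2 : w2 = 1 / (2 * c2))
    (heps : exists M : R, forall N i : nat, (i < N)%nat -> Rabs (eps2 N i) <= M) :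
  is_lim_seq (fun N => mq_rk2 f a b u0 c2 a21 w1 w2 eps2 N N) (u b).
Proof.
  subst a21.
  assert (hw : w1 + w2 = 1) by lra.
  clear hw1 hw2.
  assert (HL0 : 0 <= L).
  { apply (lipschitz_const_nonneg (f a)); intros; apply hL; unfold Icc; lra. }
  destruct heps as [M HM].
  assert (HM0 : 0 <= M).
  { pose proof (HM 1%nat 0%nat ltac:(lia)).
    pose proof (Rabs_pos (eps2 1%nat 0%nat)); lra. }
  set (v := fun t => u (clamp a b t)).
  assert (Hv : forall t, Icc a b t -> v t = u t)
    by (intros t Ht; unfold v; now rewrite clamp_id).
  assert (Hvc : forall t, continuous v t).
  { intros t; apply continuous_comp_clamp; [lra|]; exact (proj1 (hu O)). }
  (* The two times are kept apart because [f] is evaluated at [t + c2 h], possibly outside [[a, b]],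
     while the solution is taken at [t]. *)
  set (F := fun s t => f (clamp A B s) (v t)).
  assert (HF : forall s t, Icc A B s -> Icc a b t -> F s t = f s (u t)).
  { intros s t Hs Ht; unfold F; now rewrite clamp_id, Hv. }
  assert (HFc : forall z, continuous (fun p : R * R => F (fst p) (snd p)) z).
  { intros z; apply continuous_comp2_clamp; [lra | exact (proj1 (hf O)) | apply Hvc]. }
  destruct (bounded_continuity v a b (fun t _ => Hvc t)) as [X HX].
  destruct (bounded_continuity (fun t => F t t) a b) as [G HG].
  { intros t _.
    apply (continuous_comp_2 (fun t => t) (fun t => t) F);
      [apply continuous_id | apply continuous_id | apply HFc]. }
  assert (HFu : forall eta : posreal, exists delta : posreal, forall s t s' t',
    Icc A B s -> Icc a b t -> Icc A B s' -> Icc a b t' ->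
    Rabs (s' - s) < delta -> Rabs (t' - t) < delta ->
    Rabs (f s' (u t') - f s (u t)) < eta).
  { intros eta.
    destruct (uniform_continuity_2d F A B a b) with (eps := eta) as [d Hd].
    - intros s t _ _; apply continuity_2d_pt_filterlim, (HFc (s, t)).
    - exists d; intros s t s' t' Hs Ht Hs' Ht' H1 H2.
      rewrite <- !HF by trivial; now apply Hd. }
  assert (Hsub : forall t, Icc a b t -> Icc A B t) by (unfold Icc; intros; lra).
  set (H := b - a).
  (* As [h <= H], the shape perturbation is at most [M c2^2 h^2 / 2 <= C h], hence at most [C H]. *)
  set (C := M * c2 ^ 2 * H / 2).
  assert (HC0 : 0 <= C).
  { unfold C, H, Rdiv; pose proof (pow2_ge_0 c2).
    repeat (lra || apply Rmult_le_pos). }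
  set (P := rate L w1 w2 c2 H (C * H)).
  set (Q := residual L w2 c2 (C * H) C X G).
  assert (HX0 : 0 <= X).
  { pose proof (HX a ltac:(lra)) as HXa; pose proof (norm_ge_0 (v a)); lra. }
  assert (HG0 : 0 <= G).
  { pose proof (HG a ltac:(lra)) as HGa; pose proof (norm_ge_0 (F a a)); lra. }
  assert (HCH : 0 <= C * H) by (apply Rmult_le_pos; unfold H; lra).
  assert (HP0 : 0 <= P).
  { unfold P, rate.
    pose proof (Rabs_pos w1); pose proof (Rabs_pos w2); pose proof (Rabs_pos c2).
    assert (0 <= H * (Rabs c2 * L))
      by (unfold H; repeat apply Rmult_le_pos; lra).
    apply Rplus_le_le_0_compat; [|do 2 (apply Rmult_le_pos; [lra|])];
      apply Rmult_le_pos; lra. }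
  assert (HQ0 : 0 <= Q).
  { unfold Q, residual.
    pose proof (Rabs_pos w2); pose proof (Rabs_pos c2).
    apply Rmult_le_pos; [lra|]; apply Rmult_le_pos; [lra|].
    apply Rplus_le_le_0_compat;
      repeat (lra || apply Rmult_le_pos). }
  set (y := fun N i => mq_rk2 f a b u0 c2 c2 w1 w2 eps2 N i).
  (* Of the two smallness conditions, [h < delta] serves the mean value point and [|c2| h < delta]
     the time of the second stage. *)
  assert (Herr : forall (eta delta : posreal),
    (forall s t s' t',
      Icc A B s -> Icc a b t -> Icc A B s' -> Icc a b t' ->
      Rabs (s' - s) < delta -> Rabs (t' - t) < delta ->
      Rabs (f s' (u t') - f s (u t)) < eta) ->
    forall N, (0 < N)%nat -> step a b N < delta -> Rabs c2 * step a b N < delta ->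
    Rabs (y N N - u b)
    <= H * (step a b N * Q + (1 + Rabs w2) * eta) * exp (H * P)).
  { intros eta delta Hd N HN Hh1 Hh2.
    set (h := step a b N) in *.
    assert (HNh : INR N * h = H) by now apply step_mult.
    assert (HN1 : 1 <= INR N) by (apply (le_INR 1); lia).
    assert (Hh0 : 0 < h).
    { unfold h, step, Rdiv; apply Rmult_lt_0_compat; [lra|].
      apply Rinv_0_lt_compat; lra. }
    assert (HhH : h <= H).
    { rewrite <- HNh; rewrite <- (Rmult_1_l h) at 1.
      apply Rmult_le_compat_r; lra. }
    assert (Heta := cond_pos eta).
    replace (u b) with (u (node a b N N))
      by (f_equal; unfold node; fold h; unfold H in HNh; lra).
    (* Gronwall is used with [p = h P] and [q = h (h Q + (1 + |w2|) eta)]; [N h = H] removes [N]. *)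
    replace (H * (h * Q + (1 + Rabs w2) * eta) * exp (H * P))
      with (INR N * (h * (h * Q + (1 + Rabs w2) * eta)) * exp (INR N * (h * P)))
      by (rewrite <- HNh, !Rmult_assoc; reflexivity).
    apply (discrete_gronwall (fun i => Rabs (y N i - u (node a b N i)))).
    - apply Rmult_le_pos; lra.
    - pose proof (Rabs_pos w2).
      apply Rmult_le_pos; [lra|].
      apply Rplus_le_le_0_compat; apply Rmult_le_pos; lra.
    - unfold y, node; simpl.
      rewrite Rmult_0_l, Rplus_0_r, hu0, Rminus_diag; apply Rabs_R0.
    - intros i Hi.
      set (t := node a b N i).
      assert (Ht : Icc a b t) by (apply node_Icc; lia || lra).
      assert (Ht' : Icc a b (node a b N (S i))) by (apply node_Icc; lia || lra).
      assert (Et : node a b N (S i) = t + h)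
        by (unfold t, node; rewrite S_INR; fold h; ring).
      rewrite Et in *.
      assert (Hxi : exists xi, t <= xi <= t + h /\
        u (t + h) - u t = f xi (u xi) * h).
      { destruct (MVT_gen v t (t + h) (fun s => f s (u s))) as (xi & Hxi & E).
        - intros s; rewrite Rmin_left, Rmax_right by lra; intros Hs.
          unfold Icc in *.
          apply (D_in_interior_is_derive a b u (fun s => f s (u s)));
            [lra | apply hode; unfold Icc; lra | exact Hv].
        - intros s _; apply continuity_pt_filterlim, Hvc.
        - rewrite Rmin_left, Rmax_right in Hxi by lra.
          exists xi; split; [exact Hxi|].
          rewrite !Hv in E by trivial; rewrite E; ring. }
      destruct Hxi as (xi & Hxi & Exi).
      assert (Hxi' : Icc a b xi) by (unfold Icc in *; lra).
      set (th := eps2 N i * (c2 * h) ^ 2 / 2).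
      assert (Hth : Rabs th <= C * h).
      { unfold th, C.
        replace (eps2 N i * (c2 * h) ^ 2 / 2)
          with (eps2 N i * (c2 ^ 2 * h / 2 * h)) by field.
        replace (M * c2 ^ 2 * H / 2 * h) with (M * (c2 ^ 2 * H / 2 * h)) by field.
        apply Rabs_mult_le; [now apply HM|].
        pose proof (pow2_ge_0 c2).
        rewrite Rabs_pos_eq
          by (unfold Rdiv; repeat (lra || apply Rmult_le_pos)).
        unfold Rdiv; repeat apply Rmult_le_compat_r; try lra.
        now apply Rmult_le_compat_l. }
      change (y N (S i)) with (y N i + h * (w1 * f t (y N i) + w2 *
        f (t + c2 * h) ((1 + th) * (y N i + h * c2 * f t (y N i))))).
      apply one_step_error with (g := f t (u t)) (s := f xi (u xi)) (th := th);
        trivial.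
      + lra.
      + eapply Rle_trans; [exact Hth|]; now apply Rmult_le_compat_l.
      + rewrite <- Hv by trivial; apply Rlt_le, HX, Ht.
      + rewrite <- HF by auto; apply Rlt_le, (HG t), Ht.
      + apply Rlt_le, Hd; auto; rewrite Rabs_pos_eq; lra.
      + apply hL; auto.
      + set (z := (1 + th) * (y N i + h * c2 * f t (y N i))).
        assert (Hs : Icc A B (t + c2 * h)) by now apply heval.
        (* The state changes first, at fixed time (Lipschitz bound), then the time, at fixed state
           (uniform continuity). *)
        replace (f (t + c2 * h) z - f t (u t))
          with ((f (t + c2 * h) z - f (t + c2 * h) (u t))
                + (f (t + c2 * h) (u t) - f t (u t))) by ring.
        apply Rabs_plus_le; [now apply hL|].
        apply Rlt_le, Hd; auto.
        * replace (t + c2 * h - t) with (c2 * h) by ring.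
          rewrite Rabs_mult, (Rabs_pos_eq h); lra.
        * rewrite Rminus_diag, Rabs_R0; apply cond_pos. }
  apply is_lim_seq_spec; intros eps.
  set (W := 1 + Rabs w2).
  assert (HW : 0 < W) by (unfold W; pose proof (Rabs_pos w2); lra).
  set (D := H * exp (H * P)).
  assert (HD : 0 < D) by (apply Rmult_lt_0_compat; [unfold H; lra|apply exp_pos]).
  (* With this [eta] the term [D W eta] is [eps / 2]; the other half is left for [D Q h]. *)
  assert (Heta : 0 < eps / (2 * D * W)).
  { apply Rdiv_lt_0_compat; [apply cond_pos|].
    repeat (lra || apply Rmult_lt_0_compat). }
  destruct (HFu (mkposreal _ Heta)) as [delta Hdelta].
  assert (Hlim : forall k, is_lim_seq (fun N => k * step a b N) 0).
  { intros k.
    replace (Finite 0) with (Rbar_mult k 0) by (simpl; f_equal; ring).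
    apply is_lim_seq_scal_l, is_lim_seq_step. }
  assert (Hsmall : forall k (r : posreal),
    eventually (fun N => k * step a b N < r)).
  { intros k r.
    pose proof (proj2 (is_lim_seq_spec _ _) (Hlim k) r) as Hr.
    revert Hr; apply filter_imp; intros N HN.
    rewrite Rminus_0_r in HN; apply Rabs_def2 in HN; lra. }
  assert (Heps2 : 0 < eps / 2) by (pose proof (cond_pos eps); lra).
  (* [N = 0] must be excluded: there [N h = b - a] fails. *)
  assert (Hpos : eventually (fun N => (0 < N)%nat))
    by (exists 1%nat; intros; lia).
  generalize (filter_and _ _ Hpos (filter_and _ _ (Hsmall 1 delta)
    (filter_and _ _ (Hsmall (Rabs c2) delta)
      (Hsmall (D * Q) (mkposreal _ Heps2))))).
  apply filter_imp; intros N (HN & H1 & H2 & H3); simpl in H3.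
  rewrite Rmult_1_l in H1.
  eapply Rle_lt_trans;
    [exact (Herr (mkposreal _ Heta) delta Hdelta N HN H1 H2)|]; simpl.
  fold W.
  replace (H * (step a b N * Q + W * (eps / (2 * D * W))) * exp (H * P))
    with (D * Q * step a b N + eps / 2); [lra|].
  replace (eps / (2 * D * W)) with (eps / 2 / D / W) by (field; lra).
  transitivity (D * (step a b N * Q + W * (eps / 2 / D / W)));
    [field; lra | unfold D; ring].
Qed.
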